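(* Consider a packing mixed integer linear program $(\mathrm{P})$, let $\mathcal{J}\subseteq2^{[n]}$ be a partition of the index set of columns of $A$, and let $G^{\mathrm{pack}}_{A,\mathcal{J}}$ be the packing interaction graph of $A$. If $G^{\mathrm{pack}}_{A,\mathcal{J}}$ is a cycle of length $K$, then: 1. If $K=3k$ with $k\in\mathbb{Z}$, $k\ge1$, then $z^{N.S.}\le\frac32z^I$. 2. If $K=3k+1$ with $k\in\mathbb{Z}$, $k\ge1$, then $z^{N.S.}\le\frac{3k+1}{2k}z^I$. 3. If $K=3k+2$ with $k\in\mathbb{Z}$, $k\ge1$, then $z^{N.S.}\le\frac{3k+2}{2k+1}z^I$. Moreover, for every integer $K\ge3$ and every $\epsilon>0$ there exist a packing mixed integer linear program with $z^I>0$ and a partition $\mathcal{J}$ of its variable indices such that $G^{\mathrm{pack}}_{A,\mathcal{J}}$ is a cycle of length $K$ and: 1. if $K=3k$ with $k\ge1$, then $z^{N.S.}\ge\left(\frac32-\epsilon\right)z^I$; 2. if $K=3k+1$ with $k\ge1$, then $z^{N.S.}\ge\left(\frac{3k+1}{2k}-\epsilon\right)z^I$; 3. if $K=3k+2$ with $k\ge1$, then $z^{N.S.}\ge\left(\frac{3k+2}{2k+1}-\epsilon\right)z^I$.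
   Context: $[n]=\{1,\dots,n\}$. The packing problem $(\mathrm{P})$ is: maximize $c^Tx$ subject to $Ax\le b$, $x_j\in\mathbb{Z}_+$ for $j\in\mathcal{L}$, $x_j\in\mathbb{R}_+$ for $j\in[n]\setminus\mathcal{L}$, where $A\in\mathbb{Q}_+^{m\times n}$, $b\in\mathbb{Q}_+^m$, $c\in\mathbb{Q}_+^n$, $\mathcal{L}\subseteq[n]$. Let $P$ be its feasible region, $P^I$ the convex hull of $P$, and $P^{LP}$ the feasible region of its linear programming relaxation; $z^I=\max\{c^Tx:x\in P^I\}$. Sparse closures: for $N\subseteq[n]$, a sparse cut on $N$ is an inequality $\alpha^Tx\le\beta$ valid for $P^I$ with $\alpha_i=0$ for all $i\notin N$; $P^{(N)}$ is the set of points of $P^{LP}$ satisfying all sparse cuts on $N$. For a partition $\mathcal{J}=\{J_1,\dots,J_q\}$ of $[n]$, the packing interaction graph $G^{\mathrm{pack}}_{A,\mathcal{J}}$ has one node $v_j$ for each block $J_j$, and distinct nodes $v_i,v_j$ are adjacent iff some row of $A$ has a nonzero entry in a column of $J_i$ and a nonzero entry in a column of $J_j$. Natural sparse closure: for each row $i\in[m]$ let $N_i$ be the union of those blocks $J_u$ for which row $i$ of $A$ has a nonzero entry in some column of $J_u$. Then $P^{N.S.}:=\bigcap_{i=1}^mP^{(N_i)}$ and $z^{N.S.}:=\max\{c^Tx:x\in P^{N.S.}\}$. *)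

(* Defs.v *)
From mathcomp Require Import all_boot all_order all_algebra.
From mathcomp Require Import boolp classical_sets reals constructive_ereal ereal.

Set Implicit Arguments.
Unset Strict Implicit.
Unset Printing Implicit Defensive.

Import Order.TTheory GRing.Theory Num.Theory.

Local Open Scope classical_set_scope.
Local Open Scope ring_scope.

Record packing_milp (m n : nat) := PackingMILP {
  constr : 'M[rat]_(m, n);
  rhs : 'cV[rat]_m;
  obj : 'cV[rat]_n;
  intvars : {set 'I_n};
  constr_ge0 : forall i j, 0 <= constr i j;
  rhs_ge0 : forall i, 0 <= rhs i 0;
  obj_ge0 : forall j, 0 <= obj j 0 }.

Definition dotmul (R : realType) (n : nat) (u v : 'cV[R]_n) : R :=
  (u^T *m v) 0 0.

Definition convex_hull (R : realType) (n : nat) (S : set 'cV[R]_n) :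
    set 'cV[R]_n :=
  [set x | exists (k : nat) (w : 'I_k -> R) (p : 'I_k -> 'cV[R]_n),
     [/\ forall i, 0 <= w i, \sum_i w i = 1, forall i, S (p i)
       & x = \sum_i w i *: p i]].

Definition lp_region (R : realType) (m n : nat) (M : packing_milp m n) :
    set 'cV[R]_n :=
  [set x | (forall i, (map_mx ratr (constr M) *m x) i 0 <= ratr (rhs M i 0))
           /\ (forall j, 0 <= x j 0)].

Definition milp_region (R : realType) (m n : nat) (M : packing_milp m n) :
    set 'cV[R]_n :=
  [set x | lp_region M x /\
           (forall j, j \in intvars M -> x j 0 \is a Num.int)].

Definition integer_hull (R : realType) (m n : nat) (M : packing_milp m n) :
    set 'cV[R]_n :=
  convex_hull (@milp_region R m n M).

Definition sparse_cut (R : realType) (m n : nat) (M : packing_milp m n)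
    (N : {set 'I_n}) (alpha : 'cV[R]_n) (beta : R) : Prop :=
  (forall x, integer_hull M x -> dotmul alpha x <= beta) /\
  (forall i, i \notin N -> alpha i 0 = 0).

Definition sparse_closure (R : realType) (m n : nat) (M : packing_milp m n)
    (N : {set 'I_n}) : set 'cV[R]_n :=
  [set x | lp_region M x /\
           (forall alpha beta, sparse_cut M N alpha beta ->
              dotmul alpha x <= beta)].

Definition row_meets (m n : nat) (M : packing_milp m n) (i : 'I_m)
    (B : {set 'I_n}) : bool :=
  [exists j in B, constr M i j != 0].

Definition row_support (m n : nat) (M : packing_milp m n)
    (J : {set {set 'I_n}}) (i : 'I_m) : {set 'I_n} :=
  (\bigcup_(B in J | row_meets M i B) B)%SET.

Definition natural_sparse_closure (R : realType) (m n : nat)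
    (M : packing_milp m n) (J : {set {set 'I_n}}) : set 'cV[R]_n :=
  [set x | forall i : 'I_m, sparse_closure M (row_support M J i) x].

(* A supremum in the extended reals: +oo when the objective is unbounded on S,
   and, the data being rational, attained on the regions below otherwise. *)
Definition opt_value (R : realType) (m n : nat) (M : packing_milp m n)
    (S : set 'cV[R]_n) : \bar R :=
  ereal_sup [set (dotmul (map_mx ratr (obj M)) x)%:E | x in S].

Definition zI (R : realType) (m n : nat) (M : packing_milp m n) : \bar R :=
  opt_value M (@integer_hull R m n M).

Definition zNS (R : realType) (m n : nat) (M : packing_milp m n)
    (J : {set {set 'I_n}}) : \bar R :=
  opt_value M (@natural_sparse_closure R m n M J).

Definition pack_graph (m n : nat) (M : packing_milp m n)
    (J : {set {set 'I_n}}) : rel {B : {set 'I_n} | B \in J} :=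
  fun B C => (B != C) && [exists i, row_meets M i (val B) && row_meets M i (val C)].

(* ordS is the cyclic successor of 'I_K. *)
Definition is_cycle_graph (V : finType) (e : rel V) (K : nat) : Prop :=
  (3 <= K)%N /\
  exists f : 'I_K -> V, bijective f /\
    forall i j, e (f i) (f j) = (j == ordS i) || (i == ordS j).

Arguments zI R {m n} M.
Arguments zNS R {m n} M J.

(* Main.v *)
(* Upper bound.  Keep the blocks whose cyclic position [i] satisfies
   [i < K - 1] and [i mod 3 <> 2]: they fall into runs of at most two adjacent
   blocks, distinct runs share no row, and [2K/3] (rounded down) blocks are
   kept.  Optimal integer points on the runs glue to a feasible point, and the
   cost restricted to one run is a sparse cut on the support of a single row;
   so a point of the natural closure has cost at most z^I on the kept blocks.
   Averaging over the [K] rotations gives [floor(2K/3) z^NS <= K z^I].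

   Lower bound.  Each block is an N x N grid of binary items, in which two
   items differing in both coordinates conflict; an item in column [b] also
   conflicts with every item of the next block outside row [b].  A block with
   both neighbours nonempty lies in one row and one column, so no three
   consecutive blocks hold two or more items each, and
   [z^I <= K + (N - 1) floor(2K/3)].  The constant point 1/N of value [K N]
   satisfies all sparse cuts on two adjacent blocks, because there it is an
   average of integer points. *)

Require Import Defs.
From mathcomp Require Import all_boot all_order all_algebra.
From mathcomp Require Import boolp classical_sets reals constructive_ereal ereal.
From mathcomp Require Import zify.

Set Implicit Arguments.
Unset Strict Implicit.
Unset Printing Implicit Defensive.

Import Order.TTheory GRing.Theory Num.Theory.

Local Open Scope ring_scope.

(** * Integer hulls, and gluing points over row-disjoint sets of columns *)

Lemma dotmulE (R : realType) (n : nat) (u v : 'cV[R]_n) :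
  dotmul u v = \sum_j u j 0 * v j 0.
Proof. by rewrite /dotmul mxE; apply: eq_bigr => j _; rewrite mxE. Qed.

Lemma milp_sub_hull (R : realType) (m n : nat) (M : packing_milp m n)
    (x : 'cV[R]_n) :
  milp_region M x -> integer_hull M x.
Proof.
move=> Mx; exists 1%N, (fun=> 1), (fun=> x).
by split=> // [|]; rewrite big_ord1 ?scale1r.
Qed.

Lemma hull_dotmul_le (R : realType) (m n : nat) (M : packing_milp m n)
    (a : 'cV[R]_n) (b : R) :
  (forall y, milp_region M y -> dotmul a y <= b) ->
  forall x, integer_hull M x -> dotmul a x <= b.
Proof.
move=> le_b x [k [w [p [w0 w1 Mp ->]]]].
rewrite /dotmul mulmx_sumr summxE -[b]mul1r -w1 mulr_suml.
by apply: ler_sum => i _; rewrite -scalemxAr mxE ler_wpM2l //; apply: le_b.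
Qed.

Lemma milp0 (R : realType) (m n : nat) (M : packing_milp m n) :
  milp_region M (0 : 'cV[R]_n).
Proof.
split=> [|j _]; last by rewrite mxE.
by split=> i; rewrite ?mulmx0 mxE // ler0q rhs_ge0.
Qed.

(* Replace the points [y t] by the bounds [v t] one index at a time. *)
Lemma separable_sum_le (R : realType) (T : finType) (V : Type) (P : V -> Prop)
    (g : T -> V -> R) (v : T -> R) (z : R) (y0 : V) :
  P y0 ->
  (forall t b, (forall y, P y -> g t y <= b) -> v t <= b) ->
  (forall y : T -> V, (forall t, P (y t)) -> \sum_t g t (y t) <= z) ->
  \sum_t v t <= z.
Proof.
move=> Py0 le_v le_g.
suff H (s : seq T) (y : T -> V) : (forall t, P (y t)) ->
    \sum_t (if t \in s then v t else g t (y t)) <= z.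
  have := H (enum T) (fun=> y0) (fun=> Py0).
  by under eq_bigr => t _ do rewrite mem_enum inE.
elim: s y => [|t s IHs] y Py; first exact: le_g.
have [ts|nts] := boolP (t \in s).
  under eq_bigr => i _.
    rewrite in_cons; have -> : (i == t) || (i \in s) = (i \in s).
      by case: eqP => // ->; rewrite ts.
    over.
  exact: IHs.
rewrite (bigD1 t) //= mem_head -lerBrDr; apply: le_v => y' Py'.
rewrite lerBrDr.
have Py2 i : P (if i == t then y' else y i) by case: eqP.
have := IHs _ Py2; rewrite (bigD1 t) //= (negPf nts) eqxx.
apply: le_trans; rewrite lerD2l; apply: ler_sum => i it.
by rewrite in_cons (negPf it).
Qed.

(** By [Drow] a row has nonzero entries in at most one [D t], so the glued point uses no more of its
    capacity than [y t] does. Columns outside every [D t] receive the empty sum 0. *)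
Lemma milp_concat (R : realType) (m n : nat) (M : packing_milp m n)
    (T : finType) (D : T -> {set 'I_n}) (y : T -> 'cV[R]_n) :
  (forall j t s, j \in D t -> j \in D s -> t = s) ->
  (forall i t s j j', j \in D t -> j' \in D s ->
     constr M i j != 0 -> constr M i j' != 0 -> t = s) ->
  (forall t, milp_region M (y t)) ->
  milp_region M (\col_j \sum_(t | j \in D t) y t j 0).
Proof.
move=> Ddisj Drow My.
have y0 t j : 0 <= y t j 0 by case: (My t) => -[].
have A0 i j : 0 <= ratr (constr M i j) :> R by rewrite ler0q constr_ge0.
split; [split=> [i|j] | move=> j jI].
- rewrite mxE.
  under eq_bigr => j _ do rewrite !mxE.
  have [[t /existsP[j /andP[jD Aj]]]|noT] :=
      pselect (exists t, [exists j, (j \in D t) && (constr M i j != 0)]).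
    have [[le_b _] _] := My t; apply: le_trans (le_b i); rewrite mxE.
    apply: ler_sum => j' _; rewrite mxE.
    have [->|Aj'] := eqVneq (constr M i j') 0; first by rewrite raddf0 !mul0r.
    rewrite ler_wpM2l // big_mkcond /= (bigD1 t) //= big1 ?addr0.
      by case: ifP.
    by move=> s st; case: ifP => // j's; rewrite (Drow i s t j' j) ?eqxx in st.
  rewrite big1 ?ler0q ?rhs_ge0 // => j _.
  have [->|Aj] := eqVneq (constr M i j) 0; first by rewrite raddf0 mul0r.
  rewrite big1 ?mulr0 // => t jt; case: noT; exists t.
  by apply/existsP; exists j; rewrite jt.
- by rewrite mxE sumr_ge0.
- by rewrite mxE rpred_sum // => t _; case: (My t) => _; apply.
Qed.

(** Coefficient vector of the sparse cuts used in the upper bound. *)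
Definition cost_on (R : realType) (m n : nat) (M : packing_milp m n)
    (D : {set 'I_n}) : 'cV[R]_n :=
  \col_j (if j \in D then ratr (obj M j 0) else 0).

Lemma dotmul_cost_on (R : realType) (m n : nat) (M : packing_milp m n)
    (D : {set 'I_n}) (x : 'cV[R]_n) :
  dotmul (cost_on R M D) x = \sum_(j in D) ratr (obj M j 0) * x j 0.
Proof.
rewrite dotmulE [RHS]big_mkcond; apply: eq_bigr => j _; rewrite mxE.
by case: ifP; rewrite ?mul0r.
Qed.

(** Any bound on the cost over [D t] valid for feasible points is a sparse cut on a row support,
    hence holds at [x]. Quantifying over all such bounds avoids proving that maxima are attained. *)
Lemma sum_separated_cost_le (R : realType) (m n : nat) (M : packing_milp m n)
    (J : {set {set 'I_n}}) (T : finType) (D : T -> {set 'I_n})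
    (x : 'cV[R]_n) (z : R) :
  (forall j t s, j \in D t -> j \in D s -> t = s) ->
  (forall i t s j j', j \in D t -> j' \in D s ->
     constr M i j != 0 -> constr M i j' != 0 -> t = s) ->
  (forall t, exists i, D t \subset row_support M J i) ->
  natural_sparse_closure M J x ->
  (forall y, milp_region M y -> dotmul (map_mx ratr (obj M)) y <= z) ->
  \sum_t dotmul (cost_on R M (D t)) x <= z.
Proof.
move=> Ddisj Drow Dsup NSx le_z.
apply: (@separable_sum_le _ _ _ (milp_region M)
  (fun t => dotmul (cost_on R M (D t))) _ _ 0) => [||y My].
- exact: milp0.
- move=> t b le_b; have [i /fintype.subsetP Di] := Dsup t.
  have [_] := NSx i; apply; split; first exact: hull_dotmul_le.
  by move=> j jN; rewrite mxE ifN //; apply: contra jN; apply: Di.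
- apply: le_trans (le_z _ (milp_concat Ddisj Drow My)).
  rewrite dotmulE; under eq_bigr => t _ do rewrite dotmul_cost_on big_mkcond.
  rewrite exchange_big le_eqVlt /=; apply/orP; left; apply/eqP.
  apply: eq_bigr => j _; rewrite !mxE mulr_sumr [RHS]big_mkcond.
  by apply: eq_bigr => t _; case: ifP.
Qed.

(** * Upper bound: averaging over rotations of a cyclic numbering *)

(** Dropping the last position keeps the final run from touching the first one across the
    wrap-around. The quotient [i %/ 3] numbers the runs. *)
Definition kept (K i : nat) : bool := (i.+1 < K)%N && (i %% 3 != 2)%N.

Lemma sum_kept (K : nat) : (\sum_(i < K.+1) kept K.+1 i = (2 * K.+1) %/ 3)%N.
Proof.
rewrite big_ord_recr /= {2}/kept ltnn addn0.
(* With the last position removed the condition on [K] holds throughout, and the summand no longer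
   depends on [K], so induction applies. *)
under eq_bigr => i _ do rewrite /kept ltnS ltn_ord /=.
elim: K => [|K IHK]; first by rewrite big_ord0.
by rewrite big_ord_recr /= IHK; case: eqP => /=; lia.
Qed.

Lemma ordS_addl (K : nat) (r i : 'I_K.+1) : ordS (r + i) = r + ordS i.
Proof. by apply: val_inj; rewrite /= modnDmr -addn1 modnDml addn1 addnS. Qed.

(** A kept [i] is not last, so its successor is [i + 1] without wrap-around; as [i] is not 2 modulo
    3, the quotient stays the same. *)
Lemma kept_adjacent (K : nat) (i i' : 'I_K.+1) :
  kept K.+1 i -> kept K.+1 i' -> i' = ordS i -> (i %/ 3 = i' %/ 3)%N.
Proof.
move=> /andP[iK i3] /andP[_ i'3] e.
have ei : i' = i.+1 :> nat by rewrite e /= modn_small.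
by lia.
Qed.

Lemma zNS_position_le (R : realType) (m n : nat) (M : packing_milp m n)
    (J : {set {set 'I_n}}) (K : nat) (pos : 'I_n -> 'I_K.+1) :
  (0 < K)%N ->
  (forall i j j', constr M i j != 0 -> constr M i j' != 0 ->
     [\/ pos j = pos j', pos j' = ordS (pos j) | pos j = ordS (pos j')]) ->
  (forall u, exists i, forall j, pos j = u \/ pos j = ordS u ->
     j \in row_support M J i) ->
  (zNS R M J <= (K.+1%:R / ((2 * K.+1) %/ 3)%:R)%:E * zI R M)%E.
Proof.
move=> K0 posrow possup.
set s := (_ %/ 3)%N; have s0 : (0 < s)%N by rewrite /s; lia.
have zI0 : (0 <= zI R M)%E.
  apply: ereal_sup_ubound; exists 0; last by rewrite /dotmul mulmx0 mxE.
  exact/milp_sub_hull/milp0.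
(* An infinite [zI] makes the right-hand side infinite, the factor being positive. *)
case zE: (zI R M) zI0 => [z| |] // z0; last first.
  by rewrite gt0_muley ?leey // lte_fin divr_gt0 ?ltr0n.
have le_z (y : 'cV[R]_n) : milp_region M y -> dotmul (map_mx ratr (obj M)) y <= z.
  move=> My; rewrite -lee_fin -zE; apply: ereal_sup_ubound.
  by exists y => //; apply: milp_sub_hull.
apply: ge_ereal_sup => _ [x NSx <-].
rewrite -EFinM lee_fin mulrAC ler_pdivlMr ?ltr0n //.
(* The run numbered [t] after rotation by [r]. The range of [t] exceeds the number of runs; surplus
   sets are empty. *)
pose D (r : 'I_K.+1) (t : 'I_K.+1) : {set 'I_n} :=
  [set j | kept K.+1 (pos j - r)%R && ((pos j - r)%R %/ 3 == t)%N]%SET.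
have HD r : \sum_t dotmul (cost_on R M (D r t)) x <= z.
  apply: (sum_separated_cost_le _ _ _ NSx le_z).
  - by move=> j t t'; rewrite !inE => /andP[_ /eqP e] /andP[_ /eqP e'];
      apply: val_inj; rewrite /= -e -e'.
  - move=> i t t' j j'; rewrite !inE => /andP[kj /eqP e] /andP[kj' /eqP e'] Aj Aj'.
    apply: val_inj => /=; rewrite -e -e'.
    have [->//|e1|e1] := posrow i j j' Aj Aj'.
      by apply: (kept_adjacent kj kj'); rewrite e1 addrC -ordS_addl addrC.
    by apply/esym/(kept_adjacent kj' kj); rewrite e1 addrC -ordS_addl addrC.
  (* The run occupies at most the rotated positions [3 * t] and [3 * t + 1], which some row covers.
     If [3 * t] is out of range, the run is empty and the value of [inord] is irrelevant. *)
  - move=> t; have [i Hi] := possup (r + inord (3 * t)).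
    exists i; apply/fintype.subsetP => j; rewrite inE => /andP[/andP[kj k3] /eqP e].
    apply: Hi; rewrite ordS_addl.
    have -> : pos j = r + (pos j - r) by rewrite addrC subrK.
    move: (pos j - r) kj k3 e => p kj k3 e.
    have t3 : (3 * t < K.+1)%N by lia.
    have [p0|p1] : (p = 3 * t :> nat)%N \/ (p = (3 * t).+1 :> nat)%N by lia.
      by left; congr (_ + _); apply: val_inj; rewrite /= inordK.
    right; congr (_ + _); apply: val_inj; rewrite /= inordK // -p1 modn_small //;
      exact: ltn_ord.
have : \sum_r \sum_t dotmul (cost_on R M (D r t)) x <= \sum_(r < K.+1) z.
  by apply: ler_sum => r _; apply: HD.
rewrite sumr_const card_ord mulr_natl; apply: le_trans.
rewrite dotmulE mulr_suml le_eqVlt; apply/orP; left; apply/eqP.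
under [RHS]eq_bigr => r _.
  under eq_bigr => t _ do rewrite dotmul_cost_on big_mkcond.
  rewrite exchange_big /=; over.
rewrite exchange_big /=; apply: eq_bigr => j _; rewrite mxE.
rewrite /s -sum_kept natr_sum mulr_sumr.
(* For fixed [j], the map from [r] to [pos j - r] permutes the positions, so column [j] is kept in
   exactly [s] rotations. *)
rewrite (reindex_inj (h := fun r => pos j - r)) /=; last first.
  by move=> a b /addrI /oppr_inj.
apply: eq_bigr => r _; set p := pos j - r.
under eq_bigr => t _ do rewrite inE -/p.
case: (kept _ p) => /=; last by rewrite big1 ?mulr0.
have pK : (p %/ 3 < K.+1)%N by rewrite (leq_ltn_trans (leq_div _ _)).
rewrite mulr1 (bigD1 (Ordinal pK)) //= eqxx big1 ?addr0 // => t tp.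
by rewrite ifN // eq_sym; apply: contra tp => /eqP e; apply/eqP/val_inj.
Qed.

(** [pos j] is the cycle index of a block containing [j]. Columns sharing a row lie in equal or
    adjacent blocks, and each edge of the cycle is witnessed by a row whose support contains both
    blocks. *)
Lemma cycle_position (m n : nat) (M : packing_milp m n)
    (J : {set {set 'I_n}}) (K : nat) :
  finset.partition J [set: 'I_n]%SET ->
  is_cycle_graph (@pack_graph m n M J) K ->
  exists pos : 'I_n -> 'I_K,
  (forall i j j', constr M i j != 0 -> constr M i j' != 0 ->
     [\/ pos j = pos j', pos j' = ordS (pos j) | pos j = ordS (pos j')]) /\
  (forall u, exists i, forall j, pos j = u \/ pos j = ordS u ->
     j \in row_support M J i).
Proof.
move=> /and3P[/eqP coverJ _ _] [K3 [f [bij_f ef]]].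
have /fin_all_exists[pos posP] (j : 'I_n) : exists u, j \in val (f u).
  have : j \in finset.cover J by rewrite coverJ inE.
  case/bigcupP => B BJ jB; have [g fg gf] := bij_f.
  by exists (g (exist _ B BJ)); rewrite gf.
exists pos; split=> [i j j' Aj Aj'|u].
  have [->|ne] := eqVneq (pos j) (pos j'); first exact: Or31.
  have : pack_graph M (f (pos j)) (f (pos j')).
    rewrite /pack_graph (inj_eq (bij_inj bij_f)) ne; apply/existsP; exists i.
    by apply/andP; split; apply/existsP; [exists j|exists j']; apply/andP.
  by rewrite ef => /orP[] /eqP; [exact: Or32|exact: Or33].
have : pack_graph M (f u) (f (ordS u)) by rewrite ef eqxx.
case/andP => _ /existsP[i /andP[iu iSu]]; exists i => j jP; apply/bigcupP.
exists (val (f (pos j))); last exact: posP.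
by rewrite (valP (f (pos j))) /=; case: jP => ->.
Qed.

(** * Successors on a cycle *)

Lemma ordS_neq (K : nat) (u : 'I_K) : (1 < K)%N -> ordS u != u.
Proof.
move=> K1; rewrite -val_eqE /=; have uK := ltn_ord u.
have [uK1|uK1] := ltnP u.+1 K; first by rewrite modn_small //; lia.
have -> : u.+1 = K by lia.
by rewrite modnn; lia.
Qed.

Lemma ordSS_neq (K : nat) (u : 'I_K) : (2 < K)%N -> ordS (ordS u) != u.
Proof.
move=> K2; rewrite -val_eqE /=; have uK := ltn_ord u.
have [uK1|uK1] := ltnP u.+1 K.
  rewrite (modn_small uK1); have [uK2|uK2] := ltnP u.+2 K.
    by rewrite modn_small //; lia.
  have -> : u.+2 = K by lia.
  by rewrite modnn; lia.
have -> : u.+1 = K by lia.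
by rewrite modnn modn_small; lia.
Qed.

(** * Stable set problems as packing programs *)

Section StableSets.

Variables (T : finType) (e : rel T).

(** One row per ordered pair, zero unless the pair is in [e]. Using the set of endpoints gives a
    loop coefficient 1, so it reads [x_p <= 1]. *)
Definition stable_constr : 'M[rat]_(#|{: T * T}|, #|T|) :=
  \matrix_(i, j) (e (enum_val i).1 (enum_val i).2 &&
    (enum_val j \in [set (enum_val i).1; (enum_val i).2]%SET))%:R.

Fact stable_constr_ge0 i j : 0 <= stable_constr i j.
Proof. by rewrite mxE ler0n. Qed.

Fact ones_ge0 n (i : 'I_n) : 0 <= (const_mx 1 : 'cV[rat]_n) i 0.
Proof. by rewrite mxE ler01. Qed.

Definition stable_milp : packing_milp #|{: T * T}| #|T| :=
  PackingMILP [set: 'I_#|T|]%SET stable_constr_ge0 (@ones_ge0 _) (@ones_ge0 _).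

Definition stable (S : {set T}) : Prop :=
  {in S &, forall p q, e p q -> p = q}.

Variable R : realType.

Definition indicator (S : {set T}) : 'cV[R]_#|T| :=
  \col_j (enum_val j \in S)%:R.

Lemma sum_enum_val (F : T -> R) : \sum_(j < #|T|) F (enum_val j) = \sum_t F t.
Proof. by rewrite -(big_enum_val F); apply: eq_bigl. Qed.

Lemma stable_rowE (x : T -> R) i :
  (map_mx ratr (constr stable_milp) *m \col_j x (enum_val j)) i 0 =
  if e (enum_val i).1 (enum_val i).2
  then \sum_(t in [set (enum_val i).1; (enum_val i).2]%SET) x t else 0.
Proof.
rewrite mxE; under eq_bigr => j _ do rewrite !mxE ratr_nat.
case: ifP => eT /=; last by rewrite big1 // => j _; rewrite mul0r.
rewrite (sum_enum_val (fun t => (t \in _)%:R * x t)) [RHS]big_mkcond.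
by apply: eq_bigr => t _; case: (t \in _); rewrite ?mul1r ?mul0r.
Qed.

Lemma stable_objE (x : T -> R) :
  dotmul (map_mx ratr (obj stable_milp)) (\col_j x (enum_val j)) = \sum_t x t.
Proof.
rewrite dotmulE -sum_enum_val; apply: eq_bigr => j _.
by rewrite !mxE rmorph1 mul1r.
Qed.

Lemma milp_indicator (S : {set T}) :
  stable S -> milp_region stable_milp (indicator S).
Proof.
move=> stS; split=> [|j _]; last first.
  by rewrite mxE; case: (_ \in S); rewrite ?rpred0 ?rpred1.
split=> [i|j]; last by rewrite mxE ler0n.
rewrite (stable_rowE (fun t => (t \in S)%:R)) mxE rmorph1.
case: ifP => eT //=; rewrite -natr_sum lern1.
rewrite (_ : (\sum_(t in _) _)%N =
  #|[set (enum_val i).1; (enum_val i).2] :&: S|%SET); last first.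
  rewrite -sum1_card big_mkcond [RHS]big_mkcond; apply: eq_bigr => t _.
  by rewrite finset.in_setI; do 2!case: (t \in _).
apply/card_le1_eqP => p q; rewrite !inE => /andP[p2 pS] /andP[q2 qS].
move: p2 q2 pS qS => /orP[]/eqP -> /orP[]/eqP -> // pS qS; last exact: stS.
by apply/esym/stS.
Qed.

(** Loops bound every entry by 1, so an integer [y] is 0/1 and [S] is its support: two nonzero
    entries joined by [e] would violate their row. *)
Lemma stable_objective_le (y : 'cV[R]_#|T|) : reflexive e ->
  milp_region stable_milp y ->
  exists2 S : {set T}, stable S &
    dotmul (map_mx ratr (obj stable_milp)) y <= #|S|%:R.
Proof.
move=> e_refl [[rowy y0] yint]; pose x t := y (enum_rank t) 0.
have yE : y = \col_j x (enum_val j).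
  by apply/colP => j; rewrite mxE /x enum_valK.
have x0 t : 0 <= x t by apply: y0.
have xrow p q : e p q -> \sum_(t in [set p; q]%SET) x t <= 1.
  move=> epq; have := rowy (enum_rank (p, q)).
  by rewrite yE stable_rowE enum_rankK /= epq mxE rmorph1.
have x1 t : x t <= 1 by have := xrow t t (e_refl t); rewrite finset.setUid big_set1.
have x_ge1 t : x t != 0 -> 1 <= x t.
  move=> xt; have /intrP[z zE] : x t \is a Num.int by apply: yint; rewrite inE.
  by move: xt (x0 t); rewrite zE intr_eq0 ler0z ler1z; lia.
exists [set t | x t != 0]%SET => [p q|].
  rewrite !inE => /x_ge1 xp /x_ge1 xq epq; apply/eqP; apply: contraT => npq.
  have := xrow p q epq; rewrite big_setU1 ?inE //= big_set1 leNgt.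
  by rewrite (lt_le_trans _ (lerD xp xq)) // ltrDl.
rewrite {1}yE stable_objE -sum1_card natr_sum [leRHS]big_mkcond.
by apply: ler_sum => t _; rewrite inE; case: eqVneq => [->|].
Qed.

End StableSets.

(** * The lower-bound instance and its largest stable sets *)

(** [(u, (a, b))] is the item in row [a] and column [b] of block [u]. *)
Definition item (K N : nat) : finType := ('I_K * ('I_N * 'I_N))%type.

(** Equality is included to make the items binary. The last clause only looks forward, which
    suffices since both orders of a pair are constrained. *)
Definition clash (K N : nat) : rel (item K N) := fun p q =>
  [|| p == q, [&& p.1 == q.1, p.2.1 != q.2.1 & p.2.2 != q.2.2]
    | (q.1 == ordS p.1) && (p.2.2 != q.2.1)].

(** Two points with distinct first coordinates share the second one, and then every point must share
    it. So [S] lies in a single line of the grid. *)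
Lemma rook_card_le (N : nat) (S : {set 'I_N * 'I_N}) :
  {in S &, forall p q, p.1 = q.1 \/ p.2 = q.2} -> (#|S| <= N)%N.
Proof.
move=> rookS.
suff [inj1|inj2] : {in S &, injective fst} \/ {in S &, injective snd}.
- by rewrite -(card_in_imset inj1) (leq_trans (max_card _)) ?card_ord.
- by rewrite -(card_in_imset inj2) (leq_trans (max_card _)) ?card_ord.
have [/existsP[p /existsP[q /and3P[pS qS npq]]]|same] :=
  boolP [exists p, exists q, [&& p \in S, q \in S & p.1 != q.1]].
  have col r : r \in S -> r.2 = p.2.
    move=> rS; have [e1|//] := rookS r p rS pS.
    have [e2|->] := rookS r q rS qS; first by rewrite -e1 e2 eqxx in npq.
    by have [e3|//] := rookS q p qS pS; rewrite e3 eqxx in npq.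
  left=> r r' rS r'S.
  by case: r r' rS r'S => [a b] [a' b'] /col /= -> /col /= -> /= ->.
right=> r r' rS r'S e2; have e1 : r.1 = r'.1.
  apply/eqP; apply: contraNT same => ne.
  by apply/existsP; exists r; apply/existsP; exists r'; rewrite rS r'S.
by case: r r' e1 e2 {rS r'S} => [a b] [a' b'] /= -> ->.
Qed.

Lemma stable_clash_card_le (K N : nat) (S : {set item K N.+1}) : (2 < K)%N ->
  stable (@clash K N.+1) S -> (#|S| <= K + N * ((2 * K) %/ 3))%N.
Proof.
move=> K3 stS; pose B u : {set 'I_N.+1 * 'I_N.+1} := [set ab | (u, ab) \in S]%SET.
have -> : #|S| = (\sum_u #|B u|)%N.
  transitivity (\sum_u \sum_ab (if (u, ab) \in S then 1 else 0))%N.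
    by rewrite pair_bigA -sum1_card big_mkcond; apply: eq_bigr => -[].
  apply: eq_bigr => u _; rewrite -sum1_card [RHS]big_mkcond.
  by apply: eq_bigr => ab _; rewrite inE.
have B_le u : (#|B u| <= N.+1)%N.
  apply: rook_card_le => p q; rewrite !inE => pS qS.
  have [|n1] := eqVneq p.1 q.1; first by left.
  have [|n2] := eqVneq p.2 q.2; first by right.
  have pq_clash : clash (u, p) (u, q) by rewrite /clash /= eqxx n1 n2 orbT.
  by left; have /(congr1 snd)/= -> := stS _ _ pS qS pq_clash.
pose F u := (1 < #|B u|)%N.
have link u v p q : v = ordS u -> p \in B u -> q \in B v -> p.2 = q.1.
  move=> -> ; rewrite !inE => pS qS; apply/eqP; apply: contraT => npq.
  have pq_clash : clash (u, p) (ordS u, q) by rewrite /clash /= eqxx npq !orbT.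
  have /(congr1 fst)/= /esym/eqP := stS _ _ pS qS pq_clash.
  by rewrite (negPf (ordS_neq _ (ltnW K3))).
(* An item of the column of [p] fixes the row in the middle block, and the row of [q] fixes its
   column, leaving one possible item there. *)
have F3 u : (F u + F (ordS u) + F (ordS (ordS u)) <= 2)%N.
  case Fu: (F u) => //; case Fv: (F (ordS u)) => //;
    case Fw: (F (ordS (ordS u))) => //.
  have /card_gt0P[p pB] : (0 < #|B u|)%N by apply: ltnW.
  have /card_gt0P[q qB] : (0 < #|B (ordS (ordS u))|)%N by apply: ltnW.
  move: Fv; rewrite /F ltnNge => /negP[]; apply/card_le1_eqP => r r' rB r'B.
  have e1 := link _ _ _ _ erefl pB rB; have e1' := link _ _ _ _ erefl pB r'B.
  have e2 := link _ _ _ _ erefl rB qB; have e2' := link _ _ _ _ erefl r'B qB.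
  by rewrite [r]surjective_pairing [r']surjective_pairing -e1 -e1' e2 e2'.
have sumF : (3 * \sum_u F u <= 2 * K)%N.
  have sumS (G : 'I_K -> nat) : (\sum_u G (ordS u) = \sum_u G u)%N.
    by rewrite [RHS](reindex_inj (@ordS_inj K)).
  (* Summing over all triples of consecutive blocks counts each block three times. *)
  have -> : (3 * \sum_u F u = \sum_u (F u + F (ordS u) + F (ordS (ordS u))))%N.
    rewrite !big_split /= (sumS (fun u => F (ordS u) : nat)).
    by rewrite (sumS (fun u => F u : nat)) !mulSn addn0 addnA.
  apply: (@leq_trans (\sum_(u < K) 2)%N); first exact: leq_sum.
  by rewrite sum_nat_const card_ord mulnC.
(* A block holds at most one item, or at most the grid side [N + 1]. *)
apply: (@leq_trans (\sum_u (1 + N * F u))%N).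
  apply: leq_sum => u _; have := B_le u; rewrite /F; case: ltnP => /=; lia.
rewrite big_split sum_nat_const card_ord muln1 -big_distrr /= leq_add2l.
by rewrite leq_mul2l; apply/orP; right; rewrite leq_divRL // mulnC.
Qed.

(** * Blocks of the instance and their interaction graph *)

Definition clash_milp (K N : nat) := stable_milp (@clash K N).

Definition block (K N : nat) (u : 'I_K) : {set 'I_#|item K N|} :=
  [set j | (enum_val j).1 == u]%SET.

Definition blocks (K N : nat) : {set {set 'I_#|item K N|}} :=
  [set block N u | u in 'I_K]%SET.

Lemma row_meets_block (K N : nat) (i : 'I_#|{: item K N * item K N}|) (u : 'I_K) :
  row_meets (clash_milp K N) i (block N u) =
  clash (enum_val i).1 (enum_val i).2 &&
  ((u == (enum_val i).1.1) || (u == (enum_val i).2.1)).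
Proof.
apply/existsP/andP => [[j /andP[]]|[cl uP]].
  rewrite inE => /eqP <-; rewrite mxE pnatr_eq0 eqb0 negbK => /andP[->].
  by rewrite !inE => /orP[]/eqP ->; rewrite eqxx ?orbT.
case/orP: uP => /eqP ->.
  exists (enum_rank (enum_val i).1); rewrite inE mxE enum_rankK cl !inE !eqxx.
  by rewrite pnatr_eq0.
exists (enum_rank (enum_val i).2); rewrite inE mxE enum_rankK cl !inE !eqxx.
by rewrite orbT pnatr_eq0.
Qed.

Lemma block_inj (K N : nat) : injective (@block K N.+1).
Proof.
move=> u v /setP /(_ (enum_rank (u, (ord0, ord0)))).
by rewrite !inE enum_rankK /= eqxx => /esym/eqP.
Qed.

Lemma blocks_partition (K N : nat) :
  finset.partition (blocks K N.+1) [set: 'I_#|item K N.+1|]%SET.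
Proof.
apply/and3P; split.
- apply/eqP/setP => j; rewrite inE; apply/bigcupP.
  exists (block N.+1 (enum_val j).1); first exact: imset_f.
  by rewrite inE.
- apply/finset.trivIsetP => _ _ /imsetP[u _ ->] /imsetP[v _ ->] ne.
  rewrite -finset.setI_eq0; apply/eqP/setP => j; rewrite !inE.
  by apply: contraNF ne => /andP[/eqP <- /eqP <-].
- apply/imsetP => -[u _ /setP/(_ (enum_rank (u, (ord0, ord0))))].
  by rewrite !inE enum_rankK /= eqxx.
Qed.

Lemma clash_cycle (K N : nat) : (2 < K)%N ->
  is_cycle_graph (@pack_graph _ _ (clash_milp K N.+2) (blocks K N.+2)) K.
Proof.
move=> K3; split=> //.
have blockP u : block N.+2 u \in blocks K N.+2 by apply: imset_f.
pose f (u : 'I_K) : {B : {set 'I_#|item K N.+2|} | B \in blocks K N.+2} :=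
  exist _ (block N.+2 u) (blockP u).
have f_inj : injective f by move=> u v /(congr1 val)/=; apply: block_inj.
exists f; split.
  apply: inj_card_bij => //; rewrite card_sig /= card_imset ?card_ord //.
  exact: block_inj.
have meet u : exists i, row_meets (clash_milp K N.+2) i (block N.+2 u) &&
    row_meets (clash_milp K N.+2) i (block N.+2 (ordS u)).
  (* Column 0 clashes with the last row of the next block; these indices differ because the grid
     side is at least 2. *)
  exists (enum_rank ((u, (ord0, ord0)), (ordS u, (ord_max, ord0)))).
  by rewrite !row_meets_block enum_rankK /clash /= !eqxx !orbT.
move=> u v; rewrite /pack_graph (inj_eq f_inj) /=; apply/andP/orP.
  case=> uv /existsP[i]; rewrite !row_meets_block => /andP[/andP[cl uP] /andP[_ vP]].
  case: (enum_val i) cl uP vP => [p q] /=.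
  (* The first two kinds of clash stay inside one block, so only the third can join distinct
     blocks. *)
  case/or3P=> [/eqP->|/and3P[/eqP-> _ _]|/andP[/eqP-> _]].
  - by rewrite !orbb => /eqP eu /eqP ev; rewrite eu ev eqxx in uv.
  - by rewrite !orbb => /eqP eu /eqP ev; rewrite eu ev eqxx in uv.
  case/orP=> /eqP eu /orP[]/eqP ev; subst u v; rewrite ?eqxx in uv *; by [|left|right].
case=> /eqP ->.
  rewrite eq_sym ordS_neq ?(ltnW K3) //; split=> //.
  by have [i ?] := meet u; apply/existsP; exists i.
rewrite ordS_neq ?(ltnW K3) //; split=> //.
by have [i ?] := meet v; apply/existsP; exists i; rewrite andbC.
Qed.

(* Column [b] of block [u] together with row [b] of the next block: averaging
   over [b] gives the constant point on both blocks. *)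
Definition matched (K N : nat) (u : 'I_K) (b : 'I_N) : {set item K N} :=
  [set p | ((p.1 == u) && (p.2.2 == b)) ||
           ((p.1 == ordS u) && (p.2.1 == b))]%SET.

(** Each half of [matched] lies in one line of its grid, and column [b] agrees with row [b] of the
    next block. With [K >= 3] the second block is not followed by the first. *)
Lemma matched_stable (K N : nat) (u : 'I_K) (b : 'I_N) : (2 < K)%N ->
  stable (@clash K N) (matched u b).
Proof.
move=> K3 [v [a c]] [w [a' c']]; rewrite !inE /= => pM qM.
have n1 (t : 'I_K) : (ordS t == t) = false.
  by rewrite (negPf (ordS_neq t (ltnW K3))).
have n2 := ordSS_neq u K3.
case/or3P=> [/eqP //|/and3P[/eqP /= vw na nc]|/andP[/eqP /= wv nc]].
  exfalso; rewrite -vw in qM; have [e|ne] := eqVneq v u.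
    rewrite e eqxx [u == _]eq_sym n1 /= !orbF in pM qM.
    by rewrite (eqP pM) (eqP qM) eqxx in nc.
  rewrite (negPf ne) /= in pM qM; case/andP: pM => _ /eqP ab.
  by case/andP: qM => _ /eqP a'b; rewrite ab a'b eqxx in na.
exfalso; rewrite wv in qM; have [e|ne] := eqVneq v u.
  rewrite e eqxx [u == _]eq_sym n1 /= orbF in pM.
  rewrite e n1 eqxx /= in qM.
  by rewrite (eqP pM) (eqP qM) eqxx in nc.
rewrite (negPf ne) /= in pM; case/andP: pM => /eqP e _.
by rewrite e (negPf n2) n1 in qM.
Qed.

(** * The constant point in the natural sparse closure *)

Section ConstantPoint.

Variables (R : realType) (K N : nat).
Hypotheses (K3 : (2 < K)%N) (N0 : (0 < N)%N).

Definition const_point : 'cV[R]_#|item K N| := const_mx N%:R^-1.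

Lemma const_point_cut (u : 'I_K) (alpha : 'cV[R]_#|item K N|) (beta : R) :
  (forall j, (enum_val j).1 != u -> (enum_val j).1 != ordS u -> alpha j 0 = 0) ->
  (forall y, milp_region (clash_milp K N) y -> dotmul alpha y <= beta) ->
  dotmul alpha const_point <= beta.
Proof.
move=> alpha0 le_beta.
have -> : dotmul alpha const_point =
    \sum_(b < N) N%:R^-1 * dotmul alpha (indicator R (matched u b)).
  under eq_bigr => b _ do rewrite dotmulE mulr_sumr.
  rewrite exchange_big /= dotmulE; apply: eq_bigr => j _; rewrite mxE.
  have [cj|] := boolP ((enum_val j).1 \in [:: u; ordS u]); last first.
    rewrite !inE negb_or => /andP[ju jSu]; rewrite (alpha0 j ju jSu) mul0r.
    by rewrite big1 // => b _; rewrite mul0r mulr0.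
  under eq_bigr => b _ do rewrite mulrCA mulrA.
  rewrite -mulr_sumr; under eq_bigr => b _ do rewrite mxE inE.
  (* Each item of the two blocks lies in exactly one matched set, indexed by its column in block [u]
     and by its row in the next. *)
  have [b0 b0P] : exists b0, forall b,
      ((enum_val j).1 == u) && ((enum_val j).2.2 == b) ||
      ((enum_val j).1 == ordS u) && ((enum_val j).2.1 == b) = (b == b0).
    move: cj; rewrite !inE => /orP[] /eqP ->.
      exists (enum_val j).2.2 => b; rewrite eqxx eq_sym.
      by rewrite [u == _]eq_sym (negPf (ordS_neq u (ltnW K3))) orbF.
    exists (enum_val j).2.1 => b; rewrite eqxx [_ == b]eq_sym.
    by rewrite (negPf (ordS_neq u (ltnW K3))).
  rewrite (bigD1 b0) //= b0P eqxx big1 ?addr0 ?mulr1 // => b bb0.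
  by rewrite b0P (negPf bb0).
have -> : beta = \sum_(b < N) N%:R^-1 * beta.
  rewrite sumr_const card_ord -[RHS]mulr_natl mulrA divff ?mul1r //.
  by rewrite pnatr_eq0 -lt0n.
apply: ler_sum => b _; rewrite ler_wpM2l ?invr_ge0 ?ler0n //.
exact/le_beta/milp_indicator/matched_stable.
Qed.

(** The constraint rows and the sparse cuts are both valid inequalities supported on two consecutive
    blocks, so [const_point_cut] handles both. *)
Lemma const_point_NS :
  natural_sparse_closure (clash_milp K N) (blocks K N) const_point.
Proof.
have supp (i : 'I_#|{: item K N * item K N}|) : exists u, forall j,
    (enum_val j).1 != u -> (enum_val j).1 != ordS u ->
    constr (clash_milp K N) i j = 0 /\
    j \notin row_support (clash_milp K N) (blocks K N) i.
  (* Clashes point forward, so the block of the first endpoint is the earlier one. *)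
  exists (enum_val i).1.1 => j ju jSu.
  have noB : ~~ row_meets (clash_milp K N) i (block N (enum_val j).1).
    rewrite row_meets_block (negPf ju) /=.
    apply/negP => /andP[cl /eqP jq]; rewrite jq in ju jSu.
    case/or3P: cl => [/eqP pq|/and3P[/eqP pq _ _]|/andP[/eqP pq _]].
    - by rewrite pq eqxx in ju.
    - by rewrite pq eqxx in ju.
    - by rewrite pq eqxx in jSu.
  split.
    apply/eqP; apply: contraNT noB => Aij; apply/existsP; exists j.
    by rewrite inE eqxx.
  apply/bigcupP => -[_ /andP[/imsetP[v _ ->] Bi]].
  by rewrite inE => /eqP ev; rewrite ev Bi in noB.
move=> i; split.
  split=> [i'|j]; last by rewrite mxE invr_ge0 ler0n.
  have [u uP] := supp i'.
  have rowE (y : 'cV[R]_#|item K N|) :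
      (map_mx ratr (constr (clash_milp K N)) *m y) i' 0 =
      dotmul (\col_j ratr (constr (clash_milp K N) i' j)) y.
    by rewrite dotmulE mxE; apply: eq_bigr => j _; rewrite !mxE.
  rewrite rowE; apply: (@const_point_cut u) => [j ju jSu|y [[rowy _] _]].
    by rewrite mxE (proj1 (uP j ju jSu)) rmorph0.
  by rewrite -rowE.
move=> alpha beta [le_beta alpha0]; have [u uP] := supp i.
apply: (@const_point_cut u) => [j ju jSu|y /milp_sub_hull]; last exact: le_beta.
exact/alpha0/(proj2 (uP j ju jSu)).
Qed.

Lemma clash_zNS_ge : ((K * N)%:R%:E <= zNS R (clash_milp K N) (blocks K N))%E.
Proof.
apply: ereal_sup_ubound; exists const_point; first exact: const_point_NS.
rewrite (_ : const_point = \col_j (fun=> N%:R^-1) (enum_val j)); last first.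
  by apply/colP => j; rewrite !mxE.
rewrite (stable_objE _ (fun=> N%:R^-1)) sumr_const !card_prod !card_ord; congr EFin.
by rewrite -[LHS]mulr_natl !natrM -!mulrA divff ?mulr1 // pnatr_eq0 -lt0n.
Qed.

End ConstantPoint.

(** * Optimal values of the instance and the asymptotic ratio *)

Lemma clash_zI (R : realType) (K N : nat) : (2 < K)%N ->
  exists z : R, [/\ zI R (clash_milp K N.+1) = z%:E, 1 <= z
    & z <= (K + N * ((2 * K) %/ 3))%:R].
Proof.
move=> K3.
have clash_refl : reflexive (@clash K N.+1) by move=> p; rewrite /clash eqxx.
have zI_le : (zI R (clash_milp K N.+1) <= (K + N * ((2 * K) %/ 3))%:R%:E)%E.
  apply: ge_ereal_sup => _ [x Ix <-]; rewrite lee_fin.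
  move: x Ix; apply: hull_dotmul_le => y /(stable_objective_le clash_refl)[S stS].
  by move/le_trans; apply; rewrite ler_nat stable_clash_card_le.
have zI_ge : (1%:E <= zI R (clash_milp K N.+1))%E.
  pose p : item K N.+1 := (Ordinal (ltnW (ltnW K3)), (ord0, ord0)).
  apply: ereal_sup_ubound; exists (indicator R [set p]%SET).
    apply/milp_sub_hull/milp_indicator => q q'.
    by rewrite !inE => /eqP -> /eqP ->.
  rewrite (stable_objE _ (fun t => (t \in [set p]%SET)%:R)).
  by rewrite (bigD1 p) //= inE eqxx big1 ?addr0 // => q; rewrite inE => /negPf ->.
by case: (zI _ _) zI_le zI_ge => [z| |] //; rewrite !lee_fin => ? ?; exists z.
Qed.

Lemma clash_ratio_ge (R : realType) (K : nat) (eps : R) : (2 < K)%N -> 0 < eps ->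
  exists N, ((K%:R / ((2 * K) %/ 3)%:R - eps)%:E * zI R (clash_milp K N.+2)
     <= zNS R (clash_milp K N.+2) (blocks K N.+2))%E.
Proof.
move=> K3 eps0; set s := (_ %/ 3)%N; set q := _ / _.
have s1 : (0 < s)%N by rewrite /s; lia.
have q0 : 0 <= q by rewrite divr_ge0 ?ler0n.
(* Since [q * s = K], the bound on [z] gives [q * z <= q * K + K * (N + 1)]; this [N] makes [eps]
   times the bound absorb the excess [q * K]. *)
exists (Num.bound (q * K%:R / eps)); set N := Num.bound _.
have NP : q * K%:R <= eps * N%:R.
  rewrite [eps * _]mulrC -ler_pdivrMr //; apply/ltW/archi_boundP.
  by rewrite divr_ge0 ?mulr_ge0 ?ler0n // ltW.
have [z [-> z1 zle]] := clash_zI R N.+1 K3.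
apply: le_trans (clash_zNS_ge R K3 (ltn0Sn _)); rewrite -EFinM lee_fin.
(* A nonpositive factor makes the left side nonpositive; otherwise the upper bound on [z] can be
   multiplied by it. *)
have [qeps|/ltW qeps] := lerP (q - eps) 0.
  by rewrite (le_trans (mulr_le0_ge0 qeps (le_trans ler01 z1))) ?ler0n.
apply: le_trans (ler_wpM2l qeps zle) _; rewrite -/s.
have qs : q * s%:R = K%:R by rewrite /q divfK // pnatr_eq0 -lt0n.
rewrite natrD !natrM mulrBl mulrDr [_ * s%:R]mulrC mulrA qs.
rewrite -[N.+2%:R]natr1 [K%:R * (_ + 1)]mulrDr mulr1 lerBlDr addrC -!addrA lerD2l.
apply: (le_trans NP); rewrite ler_wpDl ?ler0n // ler_wpM2l ?(ltW eps0) //.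
rewrite -natrM -natrD ler_nat; nia.
Qed.

(** * Both bounds, by the residue of the cycle length modulo 3 *)

Theorem theorem17 (R : realType) :
  (forall (m n : nat) (M : packing_milp m n) (J : {set {set 'I_n}}) (K : nat),
     finset.partition J [set: 'I_n]%SET ->
     is_cycle_graph (@pack_graph m n M J) K ->
     [/\ forall k : nat, (1 <= k)%N -> K = (3 * k)%N ->
           (zNS R M J <= (3%:R / 2%:R)%:E * zI R M)%E,
         forall k : nat, (1 <= k)%N -> K = (3 * k + 1)%N ->
           (zNS R M J <= ((3 * k + 1)%:R / (2 * k)%:R)%:E * zI R M)%E
       & forall k : nat, (1 <= k)%N -> K = (3 * k + 2)%N ->
           (zNS R M J <= ((3 * k + 2)%:R / (2 * k + 1)%:R)%:E * zI R M)%E])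
  /\
  (forall (K : nat) (eps : R), (3 <= K)%N -> 0 < eps ->
     exists (m n : nat) (M : packing_milp m n) (J : {set {set 'I_n}}),
       [/\ finset.partition J [set: 'I_n]%SET,
           is_cycle_graph (@pack_graph m n M J) K,
           (0 < zI R M)%E /\ (zI R M < +oo)%E
         & [/\ forall k : nat, (1 <= k)%N -> K = (3 * k)%N ->
                 ((3%:R / 2%:R - eps)%:E * zI R M <= zNS R M J)%E,
               forall k : nat, (1 <= k)%N -> K = (3 * k + 1)%N ->
                 (((3 * k + 1)%:R / (2 * k)%:R - eps)%:E * zI R M
                    <= zNS R M J)%E
             & forall k : nat, (1 <= k)%N -> K = (3 * k + 2)%N ->
                 (((3 * k + 2)%:R / (2 * k + 1)%:R - eps)%:E * zI R M
                    <= zNS R M J)%E]]).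
Proof.
split=> [m n M J K partJ cycM|K eps K3 eps0].
  have K3 : (2 < K)%N by case: cycM.
  have [pos [posrow possup]] := cycle_position partJ cycM.
  (* Writing the length as a successor gives the positions their additive group structure. *)
  case: K {cycM} K3 pos posrow possup => // K K3 pos posrow possup.
  have := zNS_position_le R (ltnW K3) posrow possup.
  set s := (_ %/ 3)%N => le_s.
  split=> k k1 Kk; move: le_s; rewrite Kk.
  - have -> : s = (2 * k)%N by rewrite /s Kk; lia.
    by rewrite !natrM -mulf_div divff ?mulr1 // pnatr_eq0 -lt0n.
  - by have -> : s = (2 * k)%N by rewrite /s Kk; lia.
  - by have -> : s = (2 * k + 1)%N by rewrite /s Kk; lia.
have [N] := clash_ratio_ge K3 eps0; set s := (_ %/ 3)%N => ge_s.
exists _, _, (clash_milp K N.+2), (blocks K N.+2).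
split; [exact: blocks_partition|exact: clash_cycle| |].
  have [z [-> z1 _]] := clash_zI R N.+1 K3.
  by rewrite lte_fin ltry (lt_le_trans ltr01 z1).
split=> k k1 Kk; move: ge_s.
- have -> : s = (2 * k)%N by rewrite /s Kk; lia.
  rewrite (_ : K%:R / (2 * k)%:R = 3%:R / 2%:R) //.
  by rewrite Kk !natrM -mulf_div divff ?mulr1 // pnatr_eq0 -lt0n.
- have -> : s = (2 * k)%N by rewrite /s Kk; lia.
  by rewrite -Kk.
- have -> : s = (2 * k + 1)%N by rewrite /s Kk; lia.
  by rewrite -Kk.
Qed.
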